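(* Let $q$ be a prime power, let $\alpha_1,\dots,\alpha_n\in\mathbb{F}_q$ be distinct, and let $k,r$ be integers with $6\le 2k\le n$ and $1\le r\le k-1$. Suppose that the code $C_1$ generated by $G_1$ is MDS. Then $C_1$ is a non-GRS MDS code.
   Context: For distinct $\alpha_1,\dots,\alpha_n\in\mathbb{F}_q$ and $1\le r\le k-1$, $G_{r,k}$ is the $k\times n$ matrix whose rows are $(\alpha_1^e,\alpha_2^e,\dots,\alpha_n^e)$ for $e=0,1,\dots,k-r-1,k-r+1,\dots,k$ in this order (all exponents from $0$ to $k$ except $k-r$; convention $0^0=1$). $G_1$ is the $k\times(n+1)$ matrix obtained by appending to $G_{r,k}$ the column $(0,0,\dots,0,1)^T$, and $C_1$ is the linear code over $\mathbb{F}_q$ generated by $G_1$. An $[N,k]$ linear code is MDS if its minimum distance is $N-k+1$. A generalized Reed-Solomon (GRS) code of length $N\le q+1$ and dimension $k$ is a code $\{(v_1f(\beta_1),\dots,v_Nf(\beta_N)) : f\in\mathbb{F}_q[x],\ \deg f\le k-1\}$ with distinct $\beta_1,\dots,\beta_N\in\mathbb{F}_q\cup\{\infty\}$ and nonzero $v_i\in\mathbb{F}_q$, where $f(\infty)$ denotes the coefficient of $x^{k-1}$ in $f$. A non-GRS MDS code is an MDS code that is not (monomially) equivalent to a GRS code. *)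

(* Defs.v *)
From HB Require Import structures.
From mathcomp Require Import all_boot all_order all_algebra all_fingroup.

Set Implicit Arguments.
Unset Strict Implicit.
Unset Printing Implicit Defensive.

Import GRing.Theory.
Local Open Scope ring_scope.

Section Codes.

Variable F : finFieldType.

Definition code_of (k N : nat) (G : 'M[F]_(k, N)) : {vspace 'rV[F]_N} :=
  <<[seq row i G | i : 'I_k]>>%VS.

Definition hweight (N : nat) (c : 'rV[F]_N) : nat :=
  #|[set j | c 0 j != 0]|.

(* The default value N is never smaller than a weight, so for a nonzero code
   this is exactly the least weight of a nonzero codeword. *)
Definition min_dist (N : nat) (C : {vspace 'rV[F]_N}) : nat :=
  \big[minn/N]_(c : 'rV[F]_N | (c \in C) && (c != 0)) hweight c.

Definition is_MDS (N : nat) (C : {vspace 'rV[F]_N}) : Prop :=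
  min_dist C = (N - \dim C + 1)%N.

(* Points of F \cup {oo} are elements of option F, with None for oo. *)
Definition eval_pt (k : nat) (f : {poly F}) (b : option F) : F :=
  if b is Some a then f.[a] else f`_(k.-1).

(* The bound N <= q + 1 follows from the injectivity of beta. *)
Definition is_GRS (N k : nat) (C : {vspace 'rV[F]_N}) : Prop :=
  \dim C = k /\
  exists (beta : 'I_N -> option F) (v : 'I_N -> F),
    [/\ injective beta,
        forall j, v j != 0
      & forall c : 'rV[F]_N, c \in C <->
          exists2 f : {poly F}, (size f <= k)%N
                              & c = \row_j (v j * eval_pt k f (beta j))].

Definition monomially_equivalent (N : nat) (C C' : {vspace 'rV[F]_N}) : Prop :=
  exists (s : 'S_N) (w : 'I_N -> F),
    (forall j, w j != 0) /\
    C' =i [set \row_j (w j * c 0 (s j)) | c : 'rV[F]_N in C].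

Definition non_GRS_MDS (N : nat) (C : {vspace 'rV[F]_N}) : Prop :=
  is_MDS C /\
  ~ exists (k : nat) (C' : {vspace 'rV[F]_N}),
      is_GRS k C' /\ monomially_equivalent C C'.

Definition Grk (n k r : nat) (alpha : 'I_n -> F) : 'M[F]_(k, n) :=
  \matrix_(i < k, j < n) alpha j ^+ (if (i < k - r)%N then i : nat else i.+1).

Definition G1 (n k r : nat) (alpha : 'I_n -> F) : 'M[F]_(k, n + 1) :=
  row_mx (Grk k r alpha) (\col_(i < k) (i.+1 == k)%:R).

End Codes.

(* Main.v *)
(** The Schur (coordinatewise) square separates the two families.  Up to a
    coordinate scaling, the square of a GRS code of dimension k' is spanned by
    the evaluations of the monomials of degree at most 2k'-2, so its dimension
    is at most 2k'-1.  The square of C_1 contains the evaluations of all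
    monomials of degree at most 2k but one; these are linearly independent,
    because a polynomial of degree less than 2k with n >= 2k roots vanishes,
    and so the square of C_1 has dimension at least 2k. *)
Require Import Defs.
From mathcomp Require Import all_boot all_order all_algebra all_fingroup.
From mathcomp Require Import finfield zify.

Set Implicit Arguments.
Unset Strict Implicit.
Unset Printing Implicit Defensive.

Import GRing.Theory.

Section SchurSquare.

Local Open Scope ring_scope.

Variable F : finFieldType.

Definition schur (N : nat) (c c' : 'rV[F]_N) : 'rV[F]_N := map2_mx *%R c c'.

Lemma eval_pt_monomials (d : nat) (h : {poly F}) (b : option F) :
  (size h <= d)%N -> eval_pt d h b = \sum_(i < d) h`_i * eval_pt d 'X^i b.
Proof.
case: b => [a|] sz_h /=.
  by rewrite (horner_coef_wide _ sz_h); apply: eq_bigr => i _; rewrite hornerXn.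
case: d sz_h => [|d] sz_h /=.
  by rewrite big_ord0 nth_default.
rewrite big_ord_recr /= coefXn eqxx mulr1 big1 ?add0r // => i _.
by rewrite coefXn gtn_eqF ?mulr0.
Qed.

(** At infinity, the coefficient of x^(2k-2) in f g receives only the product of the two
    coefficients of x^(k-1), all higher ones being zero. *)
Lemma eval_ptM (k : nat) (f g : {poly F}) (b : option F) :
  (size f <= k)%N -> (size g <= k)%N ->
  eval_pt k.*2.-1 (f * g) b = eval_pt k f b * eval_pt k g b.
Proof.
case: b => [a|] sz_f sz_g /=; first by rewrite hornerM.
case: k sz_f sz_g => [|k] sz_f sz_g /=.
  have -> : f = 0 by apply/eqP; rewrite -size_poly_leq0.
  by rewrite mul0r coef0 mul0r.
have lt_k : (k < k.*2.+1)%N by lia.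
rewrite coefM (bigD1 (Ordinal lt_k)) //= big1 ?addr0 => [|i].
  by congr (_ * g`_ _); lia.
rewrite -val_eqE /= => ne_ik.
have [lt_ik|le_ki] := ltnP i k.
  by rewrite [g`_ _]nth_default ?mulr0 //; apply: leq_trans sz_g _; lia.
by rewrite nth_default ?mul0r //; apply: leq_trans sz_f _; lia.
Qed.

Definition GRS_word (N k : nat) (u : 'I_N -> F) (b : 'I_N -> option F)
  (f : {poly F}) : 'rV[F]_N := \row_j (u j * eval_pt k f (b j)).

Definition eval_mx (N d : nat) (u : 'I_N -> F) (b : 'I_N -> option F) :
  'M[F]_(d, N) := \matrix_(i, j) (u j * eval_pt d 'X^i (b j)).

(** The at most 2k-1 coefficients of f g are the coordinates of the Schur product in the rows of
    [eval_mx]; the number of these rows later bounds the rank. *)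
Lemma schur_GRS_sub (N k : nat) (u : 'I_N -> F) (b : 'I_N -> option F)
    (f g : {poly F}) :
  (size f <= k)%N -> (size g <= k)%N ->
  (schur (GRS_word k u b f) (GRS_word k u b g)
     <= eval_mx k.*2.-1 (fun j => (u j ^+ 2)%R) b)%MS.
Proof.
move=> sz_f sz_g; apply/submxP; exists (\row_i (f * g)`_i).
apply/rowP=> j; rewrite !mxE mulrACA -expr2 -eval_ptM // eval_pt_monomials.
  by rewrite mulr_sumr; apply: eq_bigr => i _; rewrite !mxE mulrCA.
apply: leq_trans (size_polyMleq _ _) _; rewrite -!subn1 leq_sub2r // -addnn.
exact: leq_add.
Qed.

(* The evaluation of X^e at the alpha j and at infinity, as a polynomial of
   degree at most d. *)
Definition monomial_row (n d : nat) (alpha : 'I_n -> F) (e : nat) :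
  'rV[F]_(n + 1) := row_mx (\row_j alpha j ^+ e) (const_mx (e == d)%:R).

(** At infinity this rests on a + b = 2k being equivalent to a = b = k, given the two bounds. *)
Lemma schur_monomial_row (n k : nat) (alpha : 'I_n -> F) (a b : nat) :
  (a <= k)%N -> (b <= k)%N ->
  schur (monomial_row k alpha a) (monomial_row k alpha b)
    = monomial_row k.*2 alpha (a + b).
Proof.
move=> le_ak le_bk; apply/rowP=> j; rewrite !mxE.
case: (split j) => i; rewrite !mxE ?exprD // -natrM mulnb.
by congr (nat_of_bool _)%:R; lia.
Qed.

Lemma row_free_monomials (n d p : nat) (alpha : 'I_n -> F) :
  injective alpha -> (p < d)%N -> (d <= n)%N ->
  row_free (\matrix_(i < d) monomial_row d alpha (bump p i)).
Proof.
move=> alpha_inj lt_pd le_dn; apply/inj_row_free => x x0.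
(* A vanishing combination of the rows becomes a polynomial; [bump p] runs through the exponents
   0..d other than p. *)
pose h : {poly F} := \sum_(i < d) x 0 i *: 'X^(bump p i).
have coef_h (i : 'I_d) : h`_(bump p i) = x 0 i.
  rewrite coef_sum (bigD1 i) //= coefZ coefXn eqxx mulr1 big1 ?addr0 // => j ji.
  rewrite coefZ coefXn (inj_eq (can_inj (bumpK p))) eq_sym.
  by rewrite (inj_eq val_inj) (negPf ji) mulr0.
(* The coordinate at infinity kills the coefficient of X^d, leaving degree below d against n
   roots. *)
have hd0 : h`_d = 0.
  move/rowP/(_ (rshift n ord0)): x0; rewrite !mxE => x0j; rewrite -[RHS]x0j.
  rewrite coef_sum; apply: eq_bigr => i _.
  by rewrite mxE row_mxEr mxE coefZ coefXn eq_sym.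
have sz_h : (size h <= d)%N.
  apply/leq_sizeP => j; rewrite leq_eqVlt => /predU1P[<- //|lt_dj].
  rewrite coef_sum big1 // => i _; rewrite coefZ coefXn gtn_eqF ?mulr0 //.
  by rewrite /bump; have := ltn_ord i; lia.
have h0 : h = 0.
  apply/eqP; apply/negP => /negP nz_h.
  have := max_poly_roots nz_h (rs := [seq alpha j | j : 'I_n]).
  rewrite (map_inj_uniq alpha_inj) enum_uniq size_map size_enum_ord.
  rewrite ltnNge (leq_trans sz_h le_dn) => notall.
  suff /notall/(_ isT) : all (root h) [seq alpha j | j : 'I_n] by [].
  apply/allP => _ /mapP[j _ ->]; apply/eqP.
  move/rowP/(_ (lshift 1 j)): x0; rewrite !mxE => x0j; rewrite -[RHS]x0j.
  rewrite horner_sum; apply: eq_bigr => i _.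
  by rewrite mxE row_mxEl mxE hornerZ hornerXn.
by apply/rowP=> i; rewrite -coef_h h0 coef0 mxE.
Qed.

(** With m removed from 0..k, the sum 1 is lost only if m = 1, and 2k-1 only if m = k-1. As k > 2,
    these cases exclude each other, so omitting a single d suffices. *)
Lemma sumset_gap (k m d : nat) :
  (2 < k)%N -> (0 < m < k)%N -> (d <= k.*2)%N ->
  d != (if m == 1 then 1 else k.*2.-1)%N ->
  exists a b, [/\ (a <= k)%N, (b <= k)%N, a != m, b != m & (a + b)%N = d].
Proof.
move=> k3 mk dk dp.
have [le_dk|lt_kd] := leqP d k.
  have [dm|dm] := eqVneq d m.
    (* Here 0 + d would use m; since d = m is not the omitted value, m is at least 2. *)
    by exists 1%N, m.-1; case: (m =P 1%N) dp => ? ?; split; lia.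
  by exists 0%N, d; split; lia.
have [dm|dm] := eqVneq d (k + m)%N.
  (* Here k + (d - k) would use m; the omitted value or k > 2 ensures k-1 differs from m. *)
  by exists k.-1, m.+1; case: (m =P 1%N) dp => ? ?; split; lia.
by exists k, (d - k)%N; split; lia.
Qed.

Lemma monomial_row_in_G1 (n k r : nat) (alpha : 'I_n -> F) (e : nat) :
  (0 < r < k)%N -> (e <= k)%N -> e != (k - r)%N ->
  monomial_row k alpha e \in code_of (G1 k r alpha).
Proof.
(* Exponents above the gap k-r sit one row earlier, so exponent k is in the last row, where the
   appended column is 1. *)
move=> rk ek em; have lt_i : ((if e < k - r then e else e.-1) < k)%N.
  by case: ifP; lia.
apply: memv_span; apply/mapP; exists (Ordinal lt_i); first exact: mem_enum.
apply/rowP=> j; rewrite !mxE; case: (split j) => i; rewrite !mxE /=.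
  by congr (_ ^+ _); do !case: ifP; lia.
by congr (nat_of_bool _)%:R; case: ifP; lia.
Qed.

Lemma dim_code_of (k N : nat) (G : 'M[F]_(k, N)) : (\dim (code_of G) <= k)%N.
Proof. by apply: leq_trans (dim_span _) _; rewrite size_map size_enum_ord. Qed.

(** C' is an image of C as a set, so the cardinals |F|^dim are compared. *)
Lemma dim_monomially_equivalent (N : nat) (C C' : {vspace 'rV[F]_N}) :
  monomially_equivalent C C' -> (\dim C' <= \dim C)%N.
Proof.
case=> s [w [_ defC']]; rewrite -(leq_exp2l (m := #|F|)) ?finNzRing_gt1 //.
by rewrite -!card_vspace (eq_card defC') leq_imset_card.
Qed.

(** Undoing the permutation and the scaling carries the points and multipliers of C' back to C. *)
Lemma monomially_equivalent_GRS (N k : nat) (C C' : {vspace 'rV[F]_N}) :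
  is_GRS k C' -> monomially_equivalent C C' ->
  exists (u : 'I_N -> F) (b : 'I_N -> option F), forall c, c \in C ->
    exists2 f : {poly F}, (size f <= k)%N & c = GRS_word k u b f.
Proof.
case=> _ [beta [v [_ _ defC']]] [s [w [nz_w eqC']]].
pose t : 'I_N -> 'I_N := (s^-1)%g.
exists (fun j => (w (t j))^-1 * v (t j)), (fun j => beta (t j)) => c Cc.
have /defC'[f sz_f /rowP def_f] : \row_j (w j * c 0 (s j)) \in C'.
  by rewrite eqC'; apply: imset_f.
exists f => //; apply/rowP=> j.
by have := def_f (t j); rewrite !mxE permKV -mulrA => <-; rewrite mulKf.
Qed.

End SchurSquare.

Theorem theorem4p7 (F : finFieldType) (n k r : nat) (alpha : 'I_n -> F)
    (alpha_inj : injective alpha)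
    (hkn : 6 <= 2 * k <= n) (hr : 1 <= r <= k - 1)
    (hMDS : is_MDS (code_of (G1 k r alpha))) :
  non_GRS_MDS (code_of (G1 k r alpha)).
Proof.
split=> // -[k' [C' [grsC' eqC']]].
have le_k'k : (k' <= k)%N.
  rewrite -(proj1 grsC').
  exact: leq_trans (dim_monomially_equivalent eqC') (dim_code_of _).
have [u [b C1_GRS]] := monomially_equivalent_GRS grsC' eqC'.
(* The omitted exponent of [sumset_gap] for the gap m = k-r. *)
pose p := (if k - r == 1 then 1 else k.*2.-1)%N.
have lt_p : (p < k.*2)%N by rewrite /p; case: ifP; lia.
have le_n : (k.*2 <= n)%N by lia.
have := row_free_monomials alpha_inj lt_p le_n.
set B := (\matrix_i _)%R => /eqP rankB.
have : (B <= eval_mx k'.*2.-1 (fun j => u j ^+ 2)%R b)%MS.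
  apply/row_subP => i; rewrite rowK.
  have [||||x [y [xk yk xm ym <-]]] := @sumset_gap k (k - r) (bump p i).
  - lia.
  - lia.
  - by rewrite /bump; have := ltn_ord i; lia.
  - by rewrite eq_sym neq_bump.
  have rk : (0 < r < k)%N by lia.
  rewrite -schur_monomial_row //.
  have [f sz_f ->] := C1_GRS _ (monomial_row_in_G1 alpha rk xk xm).
  have [g sz_g ->] := C1_GRS _ (monomial_row_in_G1 alpha rk yk ym).
  exact: schur_GRS_sub.
(* The ranks give 2k <= 2k'-1 (or 2k <= 0 if k' = 0), against k' <= k. *)
move/mxrankS; rewrite rankB => /leq_trans/(_ (rank_leq_row _)); lia.
Qed.
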